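(* Let $(\mathfrak{A},\theta)$ be a $\mathbb{Z}_2$-graded unital $C^*$-algebra, and let $(\mathfrak{A}_1,\theta_1)$ and $(\mathfrak{A}_2,\theta_2)$ be two $\mathbb{Z}_2$-graded $C^*$-subalgebras of $(\mathfrak{A},\theta)$, containing the identity of $\mathfrak{A}$, with $\theta(\mathfrak{A}_i)\subset\mathfrak{A}_i$ and $\theta_i:=\theta|_{\mathfrak{A}_i}$, $i=1,2$. Suppose that $\mathfrak{A}_1$ and $\mathfrak{A}_2$ commute with grading, i.e. satisfy $(C)_{\mathbb{Z}_2}$. If $\mathfrak{A}_1$ and $\mathfrak{A}_2$ satisfy $(S)$, then they satisfy $(C^*I)_{\mathbb{Z}_2}$.
   Context: A $\mathbb{Z}_2$-graded $C^*$-algebra is a pair $(\mathfrak{A},\theta)$ where $\mathfrak{A}$ is a unital $C^*$-algebra and $\theta$ is a $*$-automorphism of $\mathfrak{A}$ with $\theta^2=\mathrm{id}_{\mathfrak{A}}$. Elements with $\theta(a)=a$ are even (grade $\partial(a)=1$), elements with $\theta(a)=-a$ are odd (grade $\partial(a)=-1$); even and odd elements are called homogeneous. A state $\varphi$ on $\mathfrak{A}$ is even if $\varphi\circ\theta=\varphi$; $\mathcal{S}_+(\mathfrak{A})$ denotes the set of even states on $(\mathfrak{A},\theta)$, and similarly $\mathcal{S}_+(\mathfrak{A}_i)$ is the set of states on $\mathfrak{A}_i$ invariant under $\theta_i$. $(C)_{\mathbb{Z}_2}$ (commutation with grading): for all homogeneous $a_1\in\mathfrak{A}_1$ and $a_2\in\mathfrak{A}_2$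 one has $a_1a_2=\varepsilon(a_1,a_2)\,a_2a_1$, where $\varepsilon(a_1,a_2)=-1$ if $\partial(a_1)=\partial(a_2)=-1$ and $\varepsilon(a_1,a_2)=1$ otherwise. $(S)$ (Schlieder property): $a_1a_2\neq 0$ for all nonzero $a_1\in\mathfrak{A}_1$ and nonzero $a_2\in\mathfrak{A}_2$. $(C^*I)_{\mathbb{Z}_2}$ ($C^*$-independence): for any even states $\varphi_1\in\mathcal{S}_+(\mathfrak{A}_1)$ and $\varphi_2\in\mathcal{S}_+(\mathfrak{A}_2)$ there is an even state $\varphi\in\mathcal{S}_+(\mathfrak{A})$ such that $\varphi|_{\mathfrak{A}_1}=\varphi_1$ and $\varphi|_{\mathfrak{A}_2}=\varphi_2$. *)

(* Defs.v *)
From HB Require Import structures.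
From mathcomp Require Import all_boot all_order all_algebra.
From mathcomp Require Import all_classical all_reals all_analysis.
From mathcomp Require Import complex.

Set Implicit Arguments.
Unset Strict Implicit.
Unset Printing Implicit Defensive.

Import Order.TTheory GRing.Theory Num.Theory.
Import numFieldNormedType.Exports.

Local Open Scope classical_set_scope.
Local Open Scope ring_scope.

(* Unital C*-algebras.  The scalars are R[i], so the norm of the underlying
   normed module is R[i]-valued (with real nonnegative values).
   Hierarchy-Builder admits no common refinement of rings and normed modules
   declared after numDomainType, which is both; so the multiplication is part of
   the mixin, and the algType structure is an instance declared below. *)
HB.mixin Record isCStarAlgebra (R : realType) A
    of CompleteNormedModule R[i] A := {
  cstar_one : A;
  cstar_mul : A -> A -> A;
  star : A -> A;
  cstar_mulA : associative cstar_mul;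
  cstar_mul1l : left_id cstar_one cstar_mul;
  cstar_mul1r : right_id cstar_one cstar_mul;
  cstar_mulDl : left_distributive cstar_mul +%R;
  cstar_mulDr : right_distributive cstar_mul +%R;
  cstar_scaleAl : forall (c : R[i]) (x y : A),
    c *: cstar_mul x y = cstar_mul (c *: x) y;
  cstar_scaleAr : forall (c : R[i]) (x y : A),
    c *: cstar_mul x y = cstar_mul x (c *: y);
  cstar_one_neq0 : cstar_one != 0;
  starK : involutive star;
  starD : {morph star : x y / x + y};
  starZ : forall (c : R[i]) (x : A), star (c *: x) = c^* *: star x;
  starM : forall x y : A, star (cstar_mul x y) = cstar_mul (star y) (star x);
  cstar_normM : forall x y : A, `|cstar_mul x y| <= `|x| * `|y|;
  cstar_norm : forall x : A, `|cstar_mul (star x) x| = `|x| ^+ 2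
}.

#[short(type="cstarAlgType")]
HB.structure Definition CStarAlgebra (R : realType) :=
  {A of CompleteNormedModule R[i] A & isCStarAlgebra R A}.

HB.instance Definition _ (R : realType) (A : cstarAlgType R) :=
  GRing.Zmodule_isNzRing.Build (CStarAlgebra.sort A)
    (@cstar_mulA R A) (@cstar_mul1l R A) (@cstar_mul1r R A)
    (@cstar_mulDl R A) (@cstar_mulDr R A) (@cstar_one_neq0 R A).

HB.instance Definition _ (R : realType) (A : cstarAlgType R) :=
  GRing.Lmodule_isLalgebra.Build R[i] (CStarAlgebra.sort A)
    (@cstar_scaleAl R A).

HB.instance Definition _ (R : realType) (A : cstarAlgType R) :=
  GRing.Lalgebra_isAlgebra.Build R[i] (CStarAlgebra.sort A)
    (@cstar_scaleAr R A).

Record z2grading (R : realType) (A : cstarAlgType R) := Z2Grading {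
  grading_aut :> {lrmorphism A -> A};
  grading_star : {morph grading_aut : x / star x};
  gradingK : involutive grading_aut
}.

Section Definitions.
Context {R : realType} {A : cstarAlgType R}.
Implicit Types (B : set A) (theta : z2grading A) (phi : A -> R[i]).

Definition cstar_subalgebra B : Prop :=
  GRing.subalg_closed (mem B) /\ (forall x, B x -> B (star x)) /\ closed B.

Definition graded_subalgebra theta B : Prop :=
  cstar_subalgebra B /\ theta @` B `<=` B.

Definition even_elt theta (a : A) : Prop := theta a = a.
Definition odd_elt theta (a : A) : Prop := theta a = - a.
Definition homogeneous theta (a : A) : Prop := even_elt theta a \/ odd_elt theta a.

(* 0 is both even and odd; the sign it receives is immaterial, since eps only
   multiplies products of its two arguments. *)
Definition eps theta (a1 a2 : A) : R[i] :=
  if `[< odd_elt theta a1 /\ odd_elt theta a2 >] then -1 else 1.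

Definition graded_commute theta (A1 A2 : set A) : Prop :=
  forall a1 a2, A1 a1 -> A2 a2 -> homogeneous theta a1 ->
    homogeneous theta a2 -> a1 * a2 = eps theta a1 a2 *: (a2 * a1).

Definition schlieder (A1 A2 : set A) : Prop :=
  forall a1 a2, A1 a1 -> A2 a2 -> a1 != 0 -> a2 != 0 -> a1 * a2 != 0.

(* States on a subalgebra B are represented by functions on A of which only the
   values on B are relevant; states on A are the case B = setT.  In the order
   of R[i], 0 <= z means that z is real and nonnegative. *)
Record is_state B phi : Prop := IsState {
  state_linear : forall (c : R[i]) (x y : A), B x -> B y ->
    phi (c *: x + y) = c * phi x + phi y;
  state_pos : forall x, B x -> 0 <= phi (star x * x);
  state1 : phi 1 = 1
}.

Definition even_state theta B phi : Prop :=
  is_state B phi /\ (forall x, B x -> phi (theta x) = phi x).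

Definition graded_cstar_independent theta (A1 A2 : set A) : Prop :=
  forall phi1 phi2, even_state theta A1 phi1 -> even_state theta A2 phi2 ->
    exists phi, [/\ even_state theta setT phi,
      forall x, A1 x -> phi x = phi1 x & forall x, A2 x -> phi x = phi2 x].

End Definitions.

(* Main.v *)
Require Import Defs.
From HB Require Import structures.
From mathcomp Require Import all_boot all_order all_algebra.
From mathcomp Require Import all_classical all_reals all_analysis.
From mathcomp Require Import complex ring lra.

(* On even elements the graded commutation relation is plain commutation, and an
   even state is determined by its restriction to the even part; so it suffices to
   find a joint extension psi of the restrictions of phi1 and phi2 to the even
   parts B1, B2, and to average it over theta.  By a Hahn-Banach argument psi
   exists unless -1 = p + a + b (modulo i times self-adjoint elements) with p
   positive, a in ker phi1 and b in ker phi2; then h1 + h2 is positive for some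
   self-adjoint hi in Bi with phii(hi) = -1.  Since hi is not positive, there are
   self-adjoint ri, si in Bi with ri hi ri = - si^2 and si <> 0, and
   (r1 r2)(h1 + h2)(r1 r2) = - (s1 r2)^2 - (r1 s2)^2 forces s1 r2 = 0, against the
   Schlieder property.  The only functional calculus needed is the square root,
   obtained from the iteration y := (x + y^2) / 2, whose limit solves
   (1 - y)^2 = 1 - x when `|x| <= 1. *)

Set Implicit Arguments.
Unset Strict Implicit.
Unset Printing Implicit Defensive.

Import Order.TTheory GRing.Theory Num.Theory.
Import numFieldNormedType.Exports.

Local Open Scope classical_set_scope.
Local Open Scope ring_scope.
Local Open Scope complex_scope.

(** * Elementary facts on C*-algebras *)

Section BasicFacts.
Context {R : realType} {A : cstarAlgType R}.
Implicit Types (x y a : A).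

Lemma le_normM x y : `|x * y| <= `|x| * `|y|.
Proof. exact: cstar_normM. Qed.

Lemma norm_starM x : `|star x * x| = `|x| ^+ 2.
Proof. exact: cstar_norm. Qed.

Lemma starMr x y : star (x * y) = star y * star x.
Proof. exact: starM. Qed.

Lemma star0 : star (0 : A) = 0.
Proof. by apply: (addrI (star 0)); rewrite -starD !addr0. Qed.

Lemma starN x : star (- x) = - star x.
Proof. by apply/eqP; rewrite -addr_eq0 -starD addNr star0. Qed.

Lemma starB x y : star (x - y) = star x - star y.
Proof. by rewrite starD starN. Qed.

Lemma star1 : star (1 : A) = 1.
Proof. by have := starMr (star 1) (1 : A); rewrite mulr1 starK mulr1. Qed.

Lemma starZr (t : R) x : star (t%:C *: x) = t%:C *: star x.
Proof. by rewrite starZ; congr (_ *: _); exact: conjc_real. Qed.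

Lemma star_half x : star (2^-1 *: x) = 2^-1 *: star x.
Proof.
have -> : 2^-1 = (2^-1)%:C :> R[i] by rewrite fmorphV rmorph_nat.
exact: starZr.
Qed.

(** The C*-identity gives [|x|^2 <= |star x| |x|], hence one inequality; applied to [star x] it
    gives the other. *)
Lemma norm_star x : `|star x| = `|x|.
Proof.
have le y : `|y| <= `|star y|.
  have [->|y0] := eqVneq y 0; first by rewrite star0.
  have := le_normM (star y) y; rewrite norm_starM expr2 ler_pM2r//.
  by rewrite normr_gt0.
by apply/le_anti; rewrite le andbT -{2}(starK x) le.
Qed.

Lemma norm1 : `|1 : A| = 1.
Proof.
have := norm_starM (1 : A); rewrite star1 mulr1.
move: `|_| (normr_eq0 (1 : A)) => n; rewrite oner_eq0 => n0 /eqP.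
rewrite -subr_eq0 expr2 -{1}(mulr1 n) -mulrBr mulf_eq0 n0 /= subr_eq0.
by move=> /eqP.
Qed.

(** The norm is [R[i]]-valued; a real representative lets elements be rescaled by real numbers,
    which [star] leaves alone. *)
Lemma norm_real x : exists2 n : R, 0 <= n & `|x| = n%:C.
Proof.
have xE : `|x| = (complex.Re `|x|)%:C by rewrite RRe_real// ger0_real// normr_ge0.
by exists (complex.Re `|x|); rewrite // -ler0c -xE normr_ge0.
Qed.

Lemma normalizeE x (n : R) : `|x| = n%:C -> n%:C *: (n^-1%:C *: x) = x.
Proof.
move=> xn; have [->|x0] := eqVneq x 0; first by rewrite !scaler0.
rewrite scalerA -rmorphM mulfV ?scale1r//.
by apply: contra_neq x0 => n0; apply/eqP; rewrite -normr_eq0 xn n0.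
Qed.

Lemma norm_normalize x (n : R) : `|x| = n%:C -> `|n^-1%:C *: x| <= 1.
Proof.
move=> xn; have n0 : 0 <= n by rewrite -ler0c -xn normr_ge0.
rewrite normrZ xn ger0_norm ?ler0c ?invr_ge0// -rmorphM.
have [->|nn0] := eqVneq n 0; first by rewrite mulr0 ler01.
by rewrite mulVf.
Qed.

Lemma unitary_norm x : star x * x = 1 -> `|x| = 1.
Proof.
move=> xx; have := norm_starM x; rewrite xx norm1 => /esym/eqP.
by rewrite sqrp_eq1 => // /eqP.
Qed.

Lemma star_mul_eq0 x : star x * x = 0 -> x = 0.
Proof.
move=> xx; have := norm_starM x; rewrite xx normr0 => /esym/eqP.
by rewrite expf_eq0 normr_eq0 => /eqP.
Qed.

Lemma lipschitz_continuous (f : A -> A) (M : R[i]) : 0 <= M ->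
  (forall x y, `|f x - f y| <= M * `|x - y|) -> continuous f.
Proof.
move=> M0 fM x; apply/cvgrPdist_lt => e e0.
have M1 : 0 < M + 1 by rewrite ltr_wpDl.
near=> y; apply: (@le_lt_trans _ _ ((M + 1) * `|x - y|)).
  by apply: (le_trans (fM _ _)); rewrite ler_wpM2r// lerDl.
rewrite -ltr_pdivlMl// mulrC; near: y; apply: cvgr_dist_lt.
  by move=> ?; apply.
by rewrite divr_gt0.
Unshelve. all: by end_near. Qed.

Lemma closed_equalizer (f g : A -> A) :
  continuous f -> continuous g -> closed [set z | f z = g z].
Proof.
move=> fc gc z /= clz; apply/eqP; rewrite -subr_eq0 -normr_le0.
apply/ler_addgt0Pr => e e0; rewrite add0r.
have e2 : 0 < e / 2 by rewrite divr_gt0.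
have nf : nbhs z [set y | `|f z - f y| < e / 2].
  by apply: cvgr_dist_lt => //; exact: fc.
have ng : nbhs z [set y | `|g z - g y| < e / 2].
  by apply: cvgr_dist_lt => //; exact: gc.
have [y [/= fgy [fy gy]]] := clz _ (filterI nf ng).
have -> : f z - g z = (f z - f y) - (g z - g y).
  by rewrite fgy opprB addrA subrK.
apply: (le_trans (ler_normB _ _)); rewrite [e]splitr.
by apply: lerD; exact: ltW.
Qed.

Lemma star_continuous : continuous (@star R A).
Proof.
by apply: (@lipschitz_continuous _ 1) => // x y; rewrite -starB norm_star mul1r.
Qed.

Lemma mull_continuous a : continuous (fun x : A => a * x).
Proof.
by apply: (@lipschitz_continuous _ `|a|) => // x y; rewrite -mulrBr le_normM.
Qed.

Lemma mulr_continuous a : continuous (fun x : A => x * a).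
Proof.
apply: (@lipschitz_continuous _ `|a|) => // x y.
by rewrite -mulrBl mulrC le_normM.
Qed.

Lemma id_continuous : continuous (fun x : A => x).
Proof. by move=> x; exact: cvg_id. Qed.

Lemma closed_selfadjoint : closed [set x : A | star x = x].
Proof. exact: closed_equalizer star_continuous id_continuous. Qed.

Lemma closed_commutant a : closed [set x : A | a * x = x * a].
Proof. exact: closed_equalizer (@mull_continuous a) (@mulr_continuous a). Qed.

Lemma closed_unit_ball : closed [set x : A | `|x| <= 1].
Proof.
move=> z clz /=; apply/ler_addgt0Pr => e e0.
have nf : nbhs z [set y | `|z - y| < e].
  by apply: cvgr_dist_lt => //; exact: id_continuous.
have [y [/= y1 zy]] := clz _ nf.
rewrite -(subrK y z) addrC; apply: (le_trans (ler_normD _ _)).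
by apply: lerD => //; exact: ltW.
Qed.

End BasicFacts.

(** * Square roots *)

(** The scalar case [x = 1] of the iteration [sqrt_iter]. Being nondecreasing and bounded by 1, it
    serves as a convergent majorant. *)
Fixpoint sqrt_bound (R : realType) (n : nat) : R :=
  if n is m.+1 then (1 + sqrt_bound R m ^+ 2) / 2 else 0.

Fixpoint sqrt_iter (R : realType) (A : cstarAlgType R) (x : A) (n : nat) : A :=
  if n is m.+1 then 2^-1 *: (x + sqrt_iter x m * sqrt_iter x m) else 0.

Section SquareRoot.
Context {R : realType} {A : cstarAlgType R}.
Implicit Types (x y z : A).

Lemma sqrt_bound_itv n : 0 <= sqrt_bound R n <= 1.
Proof. by elim: n => [|n /andP[? ?]] /=; [rewrite lexx ler01|apply/andP; split; nra]. Qed.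

Lemma sqrt_bound_step n : sqrt_bound R n <= sqrt_bound R n.+1.
Proof. by have /andP[? ?] := sqrt_bound_itv n; rewrite /=; nra. Qed.

Lemma sqrt_bound_homo : {homo sqrt_bound R : n m / (n <= m)%N >-> n <= m}.
Proof. by apply/nondecreasing_seqP => n; exact: sqrt_bound_step. Qed.

Lemma half_ge0 : 0 <= (2^-1 : R[i]).
Proof. by rewrite invr_ge0 ler0n. Qed.

Lemma sqr_dist x y :
  `|x * x - y * y| <= (`|x| + `|y|) * `|x - y|.
Proof.
have -> : x * x - y * y = x * (x - y) + (x - y) * y.
  by rewrite mulrBr mulrBl addrA subrK.
apply: (le_trans (ler_normD _ _)); rewrite [leRHS]mulrDl; apply: lerD.
  exact: le_normM.
by rewrite mulrC; exact: le_normM.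
Qed.

Lemma sqrt_iter_le x : `|x| <= 1 -> forall n, `|sqrt_iter x n| <= (sqrt_bound R n)%:C.
Proof.
move=> x1; elim=> [|n IH] /=; first by rewrite normr0.
have -> : ((1 + sqrt_bound R n ^+ 2) / 2)%:C =
    2^-1 * (1 + (sqrt_bound R n)%:C ^+ 2).
  by rewrite rmorphM rmorphD rmorphXn fmorphV rmorph1 rmorph_nat mulrC.
rewrite normrZ ger0_norm ?half_ge0// ler_wpM2l ?half_ge0//.
apply: (le_trans (ler_normD _ _)); apply: lerD => //.
apply: (le_trans (le_normM _ _)); rewrite expr2.
by apply: ler_pM.
Qed.

(** Successive differences satisfy [y_(n+2) - y_(n+1) = (y_(n+1)^2 - y_n^2) / 2]; the majorant obeys
    the same recursion, where the difference of squares factors exactly. *)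
Lemma sqrt_iter_step x : `|x| <= 1 -> forall n,
  `|sqrt_iter x n.+1 - sqrt_iter x n| <=
    (sqrt_bound R n.+1 - sqrt_bound R n)%:C.
Proof.
move=> x1; elim=> [|n IH].
  rewrite /= mulr0 addr0 subr0 normrZ ger0_norm ?half_ge0//.
  rewrite expr0n addr0 subr0 rmorphM rmorph1 mul1r fmorphV rmorph_nat.
  by rewrite ler_piMr ?half_ge0.
set y := sqrt_iter x in IH *; set q := sqrt_bound R in IH *.
have -> : y n.+2 - y n.+1 = 2^-1 *: (y n.+1 * y n.+1 - y n * y n).
  rewrite {1}/y /= -/(y n.+1) {3}/y /= -/(y n).
  by rewrite -scalerBr opprD addrACA subrr add0r.
have -> : (q n.+2 - q n.+1)%:C = 2^-1 * (((q n.+1)%:C + (q n)%:C) * (q n.+1 - q n)%:C).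
  rewrite -rmorphD -rmorphM -(rmorph_nat (real_complex R)) -fmorphV -rmorphM.
  have qS m : q m.+1 = (1 + q m ^+ 2) / 2 by [].
  congr (_ %:C); rewrite (qS n.+1) {2}(qS n).
  by move: (q n.+1) (q n) => s t; field.
rewrite normrZ ger0_norm ?half_ge0// ler_wpM2l ?half_ge0//.
apply: (le_trans (sqr_dist _ _)); apply: ler_pM => //.
by apply: lerD; exact: sqrt_iter_le.
Qed.

Lemma sqrt_iter_dist x : `|x| <= 1 -> forall n m, (n <= m)%N ->
  `|sqrt_iter x m - sqrt_iter x n| <= (sqrt_bound R m - sqrt_bound R n)%:C.
Proof.
move=> x1 n m /subnK <-; elim: (m - n)%N => [|k IH].
  by rewrite add0n !subrr normr0.
rewrite addSn.
rewrite -(subrK (sqrt_iter x (k + n)) (sqrt_iter x (k + n).+1)) -addrA.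
rewrite -(subrK (sqrt_bound R (k + n)) (sqrt_bound R (k + n).+1)) -[_ + _ - sqrt_bound R n]addrA.
apply: (le_trans (ler_normD _ _)); rewrite rmorphD.
by apply: lerD => //; exact: sqrt_iter_step.
Qed.

Lemma sqrt_iter_cvg x : `|x| <= 1 -> cvgn (sqrt_iter x).
Proof.
move=> x1; apply: cauchy_cvg; apply: cauchy_exP => e e0.
have qcvg : cvgn (sqrt_bound R).
  apply: nondecreasing_is_cvgn; first exact: sqrt_bound_homo.
  by exists 1 => _ [n _ <-]; case/andP: (sqrt_bound_itv n).
have eE : e = (complex.Re e)%:C by rewrite RRe_real// ger0_real// ltW.
have re0 : 0 < complex.Re e by rewrite -ltcR -eE.
move/cvgrPdist_lt: (qcvg) => /(_ _ re0) [N _ qN].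
exists (sqrt_iter x N); exists N => // m /= Nm.
rewrite -ball_normE /= distrC.
apply: (le_lt_trans (sqrt_iter_dist x1 Nm)); rewrite eE ltcR.
have := qN N (leqnn N); rewrite /= ger0_norm ?subr_ge0; last first.
  exact: nondecreasing_cvgn_le sqrt_bound_homo qcvg N.
apply: le_lt_trans; rewrite lerD2r.
exact: nondecreasing_cvgn_le sqrt_bound_homo qcvg m.
Qed.

(** The last clause replaces membership in the closed algebra generated by [x]: the limit inherits
    every closed property that holds at 0 and survives one step of the iteration. *)
Lemma sqrt_one_minus x : `|x| <= 1 ->
  exists y, [/\ `|y| <= 1, (1 - y) * (1 - y) = 1 - x &
    forall C : set A, closed C -> C 0 ->
      (forall z, C z -> C (2^-1 *: (x + z * z))) -> C y].
Proof.
move=> x1; have ycvg := sqrt_iter_cvg x1.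
set l := limn (sqrt_iter x) in ycvg.
have Cl (C : set A) : closed C -> C 0 ->
    (forall z, C z -> C (2^-1 *: (x + z * z))) -> C l.
  move=> Ccl C0 CS; apply: (closed_cvg _ Ccl _ _ ycvg).
  by apply: nearW; elim=> [|n] /=; [exact: C0|exact: CS].
have l1 : `|l| <= 1.
  apply: (Cl [set z : A | `|z| <= 1]) => /=; first exact: closed_unit_ball.
    by rewrite normr0.
  move=> z z1; rewrite normrZ ger0_norm ?half_ge0// ler_pdivrMl ?ltr0n// mulr1.
  rewrite (_ : 2 = 1 + 1)//; apply: (le_trans (ler_normD _ _)); apply: lerD => //.
  by apply: (le_trans (le_normM _ _)); rewrite mulr_ile1.
exists l; split=> //.
suff lE : l = 2^-1 *: (x + l * l).
  have : l + l = x + l * l.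
    rewrite {1 2}lE -scalerDr -mulr2n -[X in _ *: X]scaler_nat scalerA.
    by rewrite mulVf ?pnatr_eq0// scale1r.
  move=> ll; have -> : x = l + l - l * l by rewrite ll addrK.
  rewrite mulrBl mul1r mulrBr mulr1 !opprB -addrA opprD.
  by congr (1 + _); rewrite addrCA.
apply/eqP; rewrite -subr_eq0 -normr_le0; apply/ler_addgt0Pr => e e0.
rewrite add0r; have e2 : 0 < e / 2 by rewrite divr_gt0.
move/cvgrPdist_lt: (ycvg) => /(_ _ e2) [N _ yN].
have yN0 := yN N (leqnn N); have yN1 := yN N.+1 (leqnSn N).
(* Both sides are compared with the iterate of index [N.+1]; the map [z => (x + z^2) / 2] does not
   increase distances in the unit ball, so each error is below [e / 2]. *)
rewrite -{1}(subrK (sqrt_iter x N.+1) l) -addrA.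
apply: (le_trans (ler_normD _ _)); rewrite [e]splitr.
apply: lerD; first exact: ltW.
apply/ltW/(le_lt_trans _ yN0); rewrite /= -scalerBr opprD addrACA subrr add0r.
rewrite normrZ ger0_norm ?half_ge0// ler_pdivrMl ?ltr0n//.
apply: (le_trans (sqr_dist _ _)).
rewrite (distrC l); apply: ler_wpM2r => //.
rewrite (_ : 2 = 1 + 1)//; apply: lerD => //.
apply: (le_trans (sqrt_iter_le x1 _)); rewrite -[1]/(1%:C) lecR.
by case/andP: (sqrt_bound_itv N).
Unshelve. all: by end_near. Qed.

End SquareRoot.

(** * Positive elements *)

Section Positivity.
Context {R : realType} {A : cstarAlgType R}.
Implicit Types (x y z a h k s : A) (C : set A).

(** Stability under [star] is left out, so that the commutant of any element qualifies; this is how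
    square roots are shown to commute with what their argument commutes with. *)
Definition closed_subalg C :=
  [/\ closed C, C 1, forall (c : R[i]) x y, C x -> C y -> C (c *: x + y)
    & forall x y, C x -> C y -> C (x * y)].

Lemma closed_subalg0 C : closed_subalg C -> C 0.
Proof. by case=> _ C1 CL _; have := CL (-1) _ _ C1 C1; rewrite scaleN1r addNr. Qed.

Lemma closed_subalgZ C : closed_subalg C -> forall (c : R[i]) x, C x -> C (c *: x).
Proof.
move=> CC c x Cx; have [_ _ CL _] := CC.
by rewrite -[_ *: _]addr0; apply: CL => //; exact: closed_subalg0.
Qed.

Lemma closed_subalgD C : closed_subalg C -> forall x y, C x -> C y -> C (x + y).
Proof. by case=> _ _ CL _ x y Cx Cy; rewrite -[x]scale1r; exact: CL. Qed.

Lemma closed_subalgB C : closed_subalg C -> forall x y, C x -> C y -> C (x - y).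
Proof. by case=> _ _ CL _ x y Cx Cy; rewrite -scaleN1r addrC; exact: CL. Qed.

Lemma closed_subalg_setT : closed_subalg [set: A].
Proof. by split=> //; exact: closedT. Qed.

Lemma closed_subalg_commutant a : closed_subalg [set x : A | a * x = x * a].
Proof.
split=> /=; first exact: closed_commutant.
- by rewrite mul1r mulr1.
- by move=> c x y ax ay; rewrite mulrDr mulrDl -scalerAr -scalerAl ax ay.
- by move=> x y ax ay; rewrite mulrA ax -mulrA ay mulrA.
Qed.

Lemma star_sqr h : star h = h -> star (h * h) = h * h.
Proof. by move=> hs; rewrite starMr hs. Qed.

Lemma sqr_eq0 h : star h = h -> h * h = 0 -> h = 0.
Proof. by move=> hs hh; apply: star_mul_eq0; rewrite hs. Qed.

Lemma sqrt_one_minus_selfadjoint x : star x = x -> `|x| <= 1 ->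
  exists y, [/\ star y = y, `|y| <= 1, (1 - y) * (1 - y) = 1 - x &
    forall C, closed_subalg C -> C x -> C y].
Proof.
move=> xs x1; have [y [y1 yE yC]] := sqrt_one_minus x1.
exists y; split=> //.
- apply: (yC [set z : A | star z = z]) => /=; first exact: closed_selfadjoint.
    exact: star0.
  by move=> z zs; rewrite star_half starD starMr xs zs.
- move=> C CC Cx; have [Ccl _ _ CM] := CC.
  apply: yC => //; first exact: closed_subalg0.
  move=> z Cz; apply: closed_subalgZ => //; apply: closed_subalgD => //.
  exact: CM.
Qed.

(** Here [k] is a square root of [1 - h^2], and it commutes with [h] because the commutant of [h] is
    a closed subalgebra containing [h^2]. *)
Lemma contraction_complement h : star h = h -> `|h| <= 1 ->
  exists k, [/\ star k = k, h * k = k * h & h * h + k * k = 1].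
Proof.
move=> hs h1.
have hh1 : `|h * h| <= 1.
  by apply: (le_trans (le_normM _ _)); rewrite mulr_ile1.
have [y [ys _ yE yC]] := sqrt_one_minus_selfadjoint (star_sqr hs) hh1.
exists (1 - y); split.
- by rewrite starB star1 ys.
- have := yC _ (closed_subalg_commutant h) (mulrA h h h).
  by rewrite /= mulrBr mulrBl mulr1 mul1r => ->.
- by rewrite yE addrC subrK.
Qed.

Lemma iscaleM x y : ('i%R *: x) * ('i%R *: y) = - (x * y).
Proof. by rewrite -scalerAl -scalerAr scalerA -expr2 sqrCi scaleN1r. Qed.

(** A self-adjoint contraction is the real part of [u = h + i k] with [star u * u = 1]. Norm bounds
    then follow from [|u| = 1], without any spectral theory. *)
Lemma unitary_of_contraction h : star h = h -> `|h| <= 1 ->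
  exists k, [/\ star k = k, star (h + 'i%R *: k) = h - 'i%R *: k,
    (h - 'i%R *: k) * (h + 'i%R *: k) = 1 & h * h + k * k = 1].
Proof.
move=> hs h1; have [k [ks hk hhkk]] := contraction_complement hs h1.
exists k; split=> //; first by rewrite starD hs starZ ks conjCi scaleNr.
rewrite mulrBl !mulrDr iscaleM -!scalerAl -!scalerAr hk.
by rewrite opprD opprK addrA addrK.
Qed.

(** The element [1 - h^2] equals [k^2], where [k] is the imaginary part of an element of norm 1 and
    hence a contraction. *)
Lemma contraction_one_minus_sqr h : star h = h -> `|h| <= 1 -> `|1 - h * h| <= 1.
Proof.
move=> hs h1; have [k [ks us uu hhkk]] := unitary_of_contraction hs h1.
have u1 : `|h + 'i%R *: k| = 1 by apply: unitary_norm; rewrite us.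
have k1 : `|k| <= 1.
  have : `|(2 * 'i%R) *: k| <= 1 + 1.
    have -> : (2 * 'i%R) *: k = (h + 'i%R *: k) - star (h + 'i%R *: k).
      rewrite us opprB [RHS]addrC addrA subrK.
      by rewrite -scalerA scaler_nat mulr2n.
    by apply: (le_trans (ler_normB _ _)); rewrite norm_star u1.
  rewrite normrZ normrM normCi mulr1 normr_nat -[1 + 1]/(2 : R[i]).
  by rewrite -{2}[2]mulr1 ler_pM2l ?ltr0n.
rewrite -hhkk addrC addKr; apply: (le_trans (le_normM _ _)).
by rewrite mulr_ile1.
Qed.

(* For self-adjoint [h], [`|t - h| <= t] says that the spectrum of [h] lies in
   [[0, 2t]]; in this form positivity is visibly stable under sums. *)
Definition cpos h := star h = h /\
  exists t : R, 0 <= t /\ `|t%:C *: 1 - h| <= t%:C.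

Lemma cpos0 : cpos 0.
Proof. by split; [exact: star0|exists 0; rewrite scale0r subr0 normr0]. Qed.

Lemma cposD x y : cpos x -> cpos y -> cpos (x + y).
Proof.
move=> [xs [s [s0 sx]]] [ys [t [t0 ty]]]; split; first by rewrite starD xs ys.
exists (s + t); split; first exact: addr_ge0.
rewrite rmorphD scalerDl opprD addrACA.
by apply: (le_trans (ler_normD _ _)); exact: lerD.
Qed.

Lemma cposZ (c : R) x : 0 <= c -> cpos x -> cpos (c%:C *: x).
Proof.
move=> c0 [xs [s [s0 sx]]]; split; first by rewrite starZr xs.
exists (c * s); split; first exact: mulr_ge0.
rewrite rmorphM -scalerA -scalerBr normrZ ger0_norm ?ler0c//.
by rewrite ler_wpM2l ?ler0c.
Qed.

(** The norm of [h] serves as [t], both in the shift and as the radius in [cpos]. Thus 1 is an order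
    unit, as the Hahn-Banach argument requires. *)
Lemma cpos_shift h : star h = h ->
  exists2 t : R, 0 <= t & cpos (t%:C *: 1 - h).
Proof.
move=> hs; have [n n0 hn] := norm_real h; exists n => //; split.
  by rewrite starB starZr star1 hs.
by exists n; split=> //; rewrite opprB addrC subrK hn.
Qed.

Lemma cpos_sqr h : star h = h -> cpos (h * h).
Proof.
move=> hs; have [n n0 hn] := norm_real h; pose g := n^-1%:C *: h.
have gs : star g = g by rewrite starZr hs.
rewrite -(normalizeE hn) -/g -scalerAl -scalerAr scalerA -rmorphM.
apply: cposZ; first exact: mulr_ge0.
split; first exact: star_sqr.
exists 1; split=> //; rewrite scale1r; apply: contraction_one_minus_sqr => //.
exact: norm_normalize.
Qed.

(** For [t > 0] one has [h = t (1 - x)] with [|x| <= 1], so that [sqrt t (1 - y)] is a root when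
    [(1 - y)^2 = 1 - x]; it is positive with radius [sqrt t] because [|y| <= 1]. *)
Lemma cpos_sqrt h : cpos h -> exists k, [/\ cpos k, k * k = h &
  forall C, closed_subalg C -> C h -> C k].
Proof.
move=> [hs [t [t0 th]]].
have [t00|tn0] := eqVneq t 0.
  exists 0; split; [exact: cpos0| |by move=> C CC _; exact: closed_subalg0].
  move: th; rewrite t00 scale0r add0r normrN normr_le0 => /eqP ->.
  by rewrite mul0r.
pose x := 1 - t^-1%:C *: h.
have hE : h = t%:C *: (1 - x).
  by rewrite opprB addrC subrK scalerA -rmorphM mulfV// scale1r.
have xs : star x = x by rewrite starB star1 starZr hs.
have x1 : `|x| <= 1.
  have -> : x = t^-1%:C *: (t%:C *: 1 - h).
    by rewrite scalerBr scalerA -rmorphM mulVf// scale1r.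
  rewrite normrZ ger0_norm ?ler0c ?invr_ge0//.
  have -> : 1 = t^-1%:C * t%:C :> R[i] by rewrite -rmorphM mulVf.
  by rewrite ler_wpM2l ?ler0c ?invr_ge0.
have [y [ys y1 yE yC]] := sqrt_one_minus_selfadjoint xs x1.
exists ((Num.sqrt t)%:C *: (1 - y)); split.
- split; first by rewrite starZr starB star1 ys.
  exists (Num.sqrt t); split; first exact: sqrtr_ge0.
  rewrite -scalerBr opprB addrC subrK normrZ ger0_norm ?ler0c ?sqrtr_ge0//.
  by rewrite ler_piMr// ler0c sqrtr_ge0.
- by rewrite -scalerAl -scalerAr scalerA -rmorphM -expr2 sqr_sqrtr// yE -hE.
- move=> C CC Ch; have [_ C1 _ _] := CC.
  apply: closed_subalgZ => //; apply: closed_subalgB => //; apply: yC => //.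
  by apply: closed_subalgB => //; exact: closed_subalgZ.
Qed.

(** The roots [a] of [h] and [b] of [- h] commute, so [u = a + i b] satisfies
    [star u * u = a^2 + b^2 = 0]. Then [u] and [star u] vanish, and so does their sum [2 a]. *)
Lemma cpos_anti h : cpos h -> cpos (- h) -> h = 0.
Proof.
move=> /cpos_sqrt[a [[sa _] aE aC]] /cpos_sqrt[b [[sb _] bE bC]].
have ha : h * a = a * h.
  by apply: (aC _ (closed_subalg_commutant h)).
have ab : a * b = b * a.
  by apply: (bC _ (closed_subalg_commutant a)); rewrite /= mulrN mulNr ha.
have us : star (a + 'i%R *: b) = a - 'i%R *: b.
  by rewrite starD sa starZ sb conjCi scaleNr.
have u0 : a + 'i%R *: b = 0.
  apply: star_mul_eq0; rewrite us.
  rewrite mulrBl !mulrDr iscaleM -!scalerAl -!scalerAr ab.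
  by rewrite opprD opprK addrA addrK aE bE subrr.
have aib : a = 'i%R *: b by apply/eqP; rewrite -subr_eq0 -us u0 star0.
have a0 : a = 0.
  have : 2 *: a = 0 by rewrite scaler_nat mulr2n {2}aib.
  by move=> /eqP; rewrite scaler_eq0 pnatr_eq0 => /eqP.
by rewrite -aE a0 mul0r.
Qed.

Lemma cposD_eq0 x y : cpos x -> cpos y -> x + y = 0 -> x = 0.
Proof.
move=> cx cy /eqP; rewrite addrC addr_eq0 => /eqP yE.
by apply: cpos_anti => //; rewrite -yE.
Qed.

(** The witnesses are twice the real part and minus twice the imaginary part of [x]. *)
Lemma cartesian_sum x : exists a b, [/\ star a = a, star b = b &
  a * a + b * b = 2 *: (x * star x + star x * x)].
Proof.
exists (x + star x), ('i%R *: (x - star x)); split.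
- by rewrite starD starK addrC.
- by rewrite starZ starB starK conjCi scaleNr -scalerN opprB.
- rewrite iscaleM; set s := star x.
  have -> : (x + s) * (x + s) = (x * x + s * s) + (x * s + s * x).
    by rewrite mulrDl !mulrDr [s * x + _]addrC addrACA.
  have -> : (x - s) * (x - s) = (x * x + s * s) - (x * s + s * x).
    by rewrite mulrBl !mulrBr opprB addrACA [- _ - _]addrC -opprD [s * x + _]addrC.
  by rewrite opprB addrC addrA subrK -mulr2n -scaler_nat.
Qed.

(* With [z = y s], both [z^* z] and [z z^*] are opposites of squares, while their
   sum is a sum of two squares of self-adjoint elements. *)
Lemma neg_square_eq0 y s : star s = s -> star y * y = - (s * s) -> y = 0.
Proof.
move=> ss yE; set m := y * star y.
have ms : star m = m by rewrite /m starMr starK.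
have [a [b [sa sb abE]]] := cartesian_sum (y * s).
have zz : (y * s) * star (y * s) = - (m * m).
  rewrite starMr ss mulrA -[y * s * s]mulrA -[s * s]opprK -yE mulrN mulNr.
  by rewrite /m !mulrA.
have zz' : star (y * s) * (y * s) = - ((s * s) * (s * s)).
  by rewrite starMr ss -mulrA [star y * _]mulrA yE mulNr mulrN !mulrA.
have s4 : cpos ((s * s) * (s * s)) by apply/cpos_sqr/star_sqr.
have mm : m * m + m * m + ((s * s) * (s * s) + (s * s) * (s * s) +
    (a * a + b * b)) = 0.
  rewrite abE zz zz' -opprD scalerN scaler_nat mulrnDl !mulr2n addrA.
  by rewrite subrr.
have m0 : m * m + m * m = 0.
  by apply: cposD_eq0 mm; repeat apply: cposD => //; exact: cpos_sqr.
have {}m0 : m = 0.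
  by apply: sqr_eq0 => //; apply: cposD_eq0 m0; exact: cpos_sqr.
by rewrite -[y]starK (@star_mul_eq0 _ _ (star y)) ?star0// starK.
Qed.

(* [r] is twice the negative part of [h], and [s = |h|^(1/2) r]. *)
Lemma cpos_dichotomy C h : closed_subalg C -> C h -> star h = h ->
  (exists k, [/\ C k, star k = k & h = k * k]) \/
  (exists r s, [/\ C r, C s & [/\ star r = r, star s = s, s != 0 &
    r * h * r = - (s * s)]]).
Proof.
move=> CC Ch hs; have [_ _ _ CM] := CC.
have [a [apos aE aC]] := cpos_sqrt (cpos_sqr hs).
have [k [[ks _] kE kC]] := cpos_sqrt apos.
have [sa _] := apos.
have Ca : C a by apply: aC => //; exact: CM.
have Ck : C k by exact: kC.
have ha : h * a = a * h.
  by apply: (aC _ (closed_subalg_commutant h)); rewrite /= mulrA.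
have hk : h * k = k * h.
  by apply: (kC _ (closed_subalg_commutant h)).
have ak : a * k = k * a.
  by apply: (kC _ (closed_subalg_commutant a)).
pose r := a - h.
have rs : star r = r by rewrite starB sa hs.
have Cr : C r by exact: closed_subalgB.
have kr : k * r = r * k by rewrite mulrBl mulrBr ak hk.
have hr : h * r = - (a * r) by rewrite !mulrBr ha aE opprB.
(* Here [a] is [|h|] and [k] its square root. If [k r = 0], then [r^2 = a r - h r = 2 a r = 0], so
   [h = a = k^2]; otherwise [s = k r] works. *)
have [s0|s0] := eqVneq (k * r) 0.
  have ar : a * r = 0 by rewrite -kE -mulrA s0 mulr0.
  left; exists k; split=> //; rewrite kE; apply/esym/eqP; rewrite -subr_eq0.
  rewrite -/r (sqr_eq0 rs) ?eqxx// {1}/r mulrBl hr ar.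
  by rewrite oppr0 subr0.
right; exists r, (k * r); split=> //; first exact: CM.
split=> //; first by rewrite starMr ks rs kr.
by rewrite -mulrA hr mulrN -kE {1}kr -!mulrA.
Qed.

(** If [star x * x] is not a square, compressing it by the [r] of the dichotomy gives
    [star (x r) * (x r) = - s^2]. Then [x r = 0], which forces [s = 0]. *)
Lemma cpos_star_mul x : cpos (star x * x).
Proof.
have xs : star (star x * x) = star x * x by rewrite starMr starK.
case: (cpos_dichotomy closed_subalg_setT I xs).
  by move=> [k [_ ks ->]]; exact: cpos_sqr.
move=> [r [s [_ _ [rs ss s0 rE]]]].
have xr : x * r = 0.
  by apply: (neg_square_eq0 ss); rewrite starMr rs -rE !mulrA.
case/eqP: s0; apply: sqr_eq0 => //; apply/eqP; rewrite -oppr_eq0 -rE.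
by rewrite mulrA -mulrA xr mulr0.
Qed.

End Positivity.

(** * Continuity of the grading *)

Section GradingContinuity.
Context {R : realType} {A : cstarAlgType R} (theta : z2grading A).
Implicit Types (x h : A).

(** The automorphism preserves the relation [star u * u = 1], and [theta h] is the real part of
    [theta u], whose norm is 1. *)
Lemma grading_contractive_selfadjoint h :
  star h = h -> `|h| <= 1 -> `|theta h| <= 1.
Proof.
move=> hs h1; have [k [ks us uu _]] := unitary_of_contraction hs h1.
set u := h + 'i%R *: k in us uu.
have tu1 : `|theta u| = 1.
  by apply: unitary_norm; rewrite -grading_star us -rmorphM uu rmorph1.
have : `|2 *: theta h| <= 1 + 1.
  have -> : 2 *: theta h = theta u + star (theta u).
    rewrite -grading_star us -rmorphD -linearZ /=; congr (theta _).
    by rewrite scaler_nat mulr2n /u addrACA subrr addr0.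
  by apply: (le_trans (ler_normD _ _)); rewrite norm_star tu1.
rewrite normrZ normr_nat -[1 + 1]/(2 : R[i]).
by rewrite -{2}[2]mulr1 ler_pM2l ?ltr0n.
Qed.

Lemma grading_contractive x : `|theta x| <= `|x|.
Proof.
have [n n0 xn] := norm_real x.
have /= := norm_normalize xn; set y := n^-1%:C *: x => y1.
have ty1 : `|theta y| <= 1.
  rewrite -(@expr_le1 _ 2)// -norm_starM -grading_star -rmorphM.
  apply: grading_contractive_selfadjoint; first by rewrite starMr starK.
  by rewrite norm_starM exprn_ile1.
rewrite -{1}(normalizeE xn) -/y linearZ normrZ ger0_norm ?ler0c//.
by rewrite xn ler_piMr// ler0c.
Qed.

(** A grading is given algebraically; its continuity is what makes the even part of a closed
    subalgebra closed. *)
Lemma grading_continuous : continuous (theta : A -> A).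
Proof.
apply: (@lipschitz_continuous _ _ _ 1) => // x y.
by rewrite -raddfB mul1r grading_contractive.
Qed.

Definition even_part (B : set A) : set A := [set x | B x /\ theta x = x].

Lemma cstar_subalgebra_closed_subalg (B : set A) : cstar_subalgebra B -> closed_subalg B.
Proof.
move=> [[B1 BL BM] [_ Bcl]]; split=> //.
- by move: B1; rewrite inE.
- by move=> c x y Bx By; have := BL c x y; rewrite !inE; apply.
- by move=> x y Bx By; have := BM x y; rewrite !inE; apply.
Qed.

Lemma closed_subalg_even_part (B : set A) :
  closed_subalg B -> closed_subalg (even_part B).
Proof.
move=> [Bcl B1 BL BM]; split.
- apply: closedI => //; apply: closed_equalizer (@id_continuous _ _).
  exact: grading_continuous.
- by split; rewrite ?rmorph1.
- move=> c x y [Bx tx] [By ty]; split; first exact: BL.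
  by rewrite rmorphD /= linearZ /= tx ty.
- move=> x y [Bx tx] [By ty]; split; first exact: BM.
  by rewrite rmorphM /= tx ty.
Qed.

End GradingContinuity.

(** * Positive functionals on a cone *)

Section ConeFunctional.
Context {R : realType} {V : lmodType R[i]}.
Implicit Types (Q M N : set V) (e v x y : V).

Definition convex_cone Q :=
  (forall x y, Q x -> Q y -> Q (x + y)) /\
  (forall (t : R) x, 0 <= t -> Q x -> Q (t%:C *: x)).

Lemma maximal_cone Q v : convex_cone Q -> ~ Q v ->
  exists M, [/\ convex_cone M, Q `<=` M, ~ M v &
    forall N, convex_cone N -> M `<=` N -> ~ N v -> N `<=` M].
Proof.
move=> Qc Qv.
(* Zorn's lemma is applied to sets [X] whose union with [Q] is a cone avoiding [v]. The empty chain,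
   with empty union, is then no exception. *)
have [F FP Ftot|X [[Xc Xv] Xmax]] :=
  @Zorn_bigcup V (fun X => convex_cone (X `|` Q) /\ ~ (X `|` Q) v); last first.
  exists (X `|` Q); split=> //.
  move=> N Nc XN Nv y Ny; left; apply: contrapT => Xy.
  apply: (Xmax N); first split.
  - by move=> x Xx; apply: XN; left.
  - by move=> NX; apply/Xy/NX.
  - suff -> : N `|` Q = N by [].
    by apply/seteqP; split=> [x [//|Qx]|x]; [apply: XN; right|left].
have inF X : F X -> X `|` Q `<=` (\bigcup_(Y in F) Y) `|` Q.
  by move=> FX x [Xx|Qx]; [left; exists X|right].
split; last by move=> [[X FX Xv]|//]; have [_] := FP _ FX; apply; left.
have [QD QZ] := Qc.
split=> [x y [[X FX Xx]|Qx] [[Y FY Yy]|Qy]|t x t0 [[X FX Xx]|Qx]].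
- have [XY|YX] := Ftot _ _ FX FY.
    have [[YD _] _] := FP _ FY; apply: (inF _ FY).
    by apply: YD; left => //; exact: XY.
  have [[XD _] _] := FP _ FX; apply: (inF _ FX).
  by apply: XD; left => //; exact: YX.
- have [[XD _] _] := FP _ FX; apply: (inF _ FX).
  by apply: XD; [left|right].
- have [[YD _] _] := FP _ FY; apply: (inF _ FY).
  by apply: YD; [right|left].
- by right; exact: QD.
- have [[_ XZ] _] := FP _ FX; apply: (inF _ FX).
  by apply: XZ => //; left.
- by right; exact: QZ.
Qed.

(** Adjoin the ray of [x] to [M]. Either the result still avoids [- e], and [x] is in [M] by
    maximality, or [- e = m + t x] with [t > 0], and [- x = (m + e) / t] is in [M]. *)
Lemma maximal_cone_total M e : convex_cone M -> M e -> ~ M (- e) ->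
  (forall N, convex_cone N -> M `<=` N -> ~ N (- e) -> N `<=` M) ->
  forall x, M x \/ M (- x).
Proof.
move=> [MD MZ] Me MNe Mmax x.
have M0 : M 0 by rewrite -(scale0r e); exact: (MZ 0).
pose N := [set z | exists m, exists2 t : R, 0 <= t & M m /\ z = m + t%:C *: x].
have Nc : convex_cone N.
  split=> [_ _ [m [s s0 [Mm ->]]] [n [t t0 [Mn ->]]]|t _ t0 [m [s s0 [Mm ->]]]].
    exists (m + n), (s + t); first exact: addr_ge0.
    by split; [exact: MD|rewrite rmorphD scalerDl addrACA].
  exists (t%:C *: m), (t * s); first exact: mulr_ge0.
  by split; [exact: MZ|rewrite scalerDr scalerA rmorphM].
have MN : M `<=` N.
  by move=> m Mm; exists m, 0 => //; split=> //; rewrite scale0r addr0.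
have [[m [t t0 [Mm eE]]]|Nv] := pselect (N (- e)); last first.
  left; apply: (Mmax N Nc MN Nv); exists 0, 1 => //.
  by split=> //; rewrite scale1r add0r.
have [t00|tn0] := eqVneq t 0.
  by case: MNe; rewrite eE t00 scale0r addr0.
right; have -> : - x = t^-1%:C *: (m + e).
  rewrite -[e]opprK eE opprD addrA subrr add0r scalerN scalerA.
  by rewrite -rmorphM mulVf// scale1r.
by apply: MZ; [rewrite invr_ge0|exact: MD].
Qed.

(** After enlarging [Q] to a maximal cone [M], the functional is [f x = sup {t | x - t e in M}]. The
    order unit [e] makes this supremum finite, and totality of [M] turns superadditivity into
    additivity. *)
Lemma cone_real_functional Q e : convex_cone Q -> ~ Q (- e) ->
  (forall x, exists2 t : R, 0 <= t & Q (t%:C *: e - x)) ->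
  exists f : V -> R, [/\ {morph f : x y / x + y},
    forall (t : R) x, f (t%:C *: x) = t * f x, f e = 1 &
    forall x, Q x -> 0 <= f x].
Proof.
move=> Qc Qe Qunit; have [M [[MD MZ] QM Me Mmax]] := maximal_cone Qc Qe.
have M1 : M e.
  have [t t0 /QM Mt] := Qunit (- e).
  have -> : e = (1 + t)^-1%:C *: (t%:C *: e - - e).
    rewrite opprK -{3}[e]scale1r -scalerDl scalerA -(rmorph1 (real_complex R)).
    by rewrite -rmorphD -rmorphM addrC mulVf ?scale1r// gt_eqF// ltr_wpDl.
  by apply: MZ => //; rewrite invr_ge0 addr_ge0.
have tot := @maximal_cone_total M e (conj MD MZ) M1 Me Mmax.
have Mneg (t : R) : M (t%:C *: e) -> 0 <= t.
  move=> Mt; rewrite leNgt; apply/negP => t0; apply: Me.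
  have -> : - e = (- t)^-1%:C *: (t%:C *: e).
    rewrite scalerA -rmorphM invrN mulNr mulVf ?lt_eqF//.
    by rewrite rmorphN rmorph1 scaleN1r.
  by apply: MZ => //; rewrite invr_ge0 oppr_ge0 ltW.
pose S x := [set t : R | M (x - t%:C *: e)].
have S0 x : S x !=set0.
  have [t _ /QM Mt] := Qunit (- x).
  by exists (- t); rewrite /S /= rmorphN scaleNr opprK addrC -[x]opprK.
have Sub x : has_ubound (S x).
  have [t _ /QM Mt] := Qunit x; exists t => s /= Ms.
  rewrite -subr_ge0; apply/Mneg; rewrite rmorphB scalerBl.
  by have := MD _ _ Mt Ms; rewrite addrA subrK.
pose f x := sup (S x).
have fge x t : S x t -> t <= f x by move=> ?; exact: ub_le_sup.
have fle x b : (forall t, S x t -> t <= b) -> f x <= b.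
  by move=> Sb; apply: ge_sup.
have fgt x t : f x < t -> M (t%:C *: e - x).
  move=> ft; have [Mx|] := tot (x - t%:C *: e); last by rewrite opprB.
  by move: ft; rewrite ltNge fge.
have f_super x y : f x + f y <= f (x + y).
  rewrite -lerBrDr; apply/fle => s Ss; rewrite lerBrDl -lerBrDr.
  apply/fle => t St; rewrite lerBrDl; apply/fge.
  by rewrite /S /= rmorphD scalerDl opprD addrACA; exact: MD.
have f_opp x : f (- x) = - f x.
  apply/le_anti/andP; split.
    apply/fle => s Ss; rewrite lerNr; apply/fle => t St.
    rewrite -subr_ge0 -opprD; apply/Mneg.
    have := MD _ _ Ss St.
    by rewrite addrACA addNr add0r -opprD -scalerDl -rmorphD rmorphN scaleNr.
  (* For [d > 0], the element [x - (f x + d) e] lies outside [M], so totality puts its opposite in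
     [M]. *)
  rewrite lerNl; apply/ler_addgt0Pr => d d0; rewrite lerNl; apply/fge.
  rewrite /S /= rmorphN scaleNr opprK addrC; apply/fgt.
  by rewrite ltrDl.
have fD : {morph f : x y / x + y}.
  move=> x y; apply/le_anti; rewrite f_super andbT.
  by have := f_super (x + y) (- y); rewrite addrK f_opp lerBlDr.
have fZ_ge (t : R) x : 0 < t -> t * f x <= f (t%:C *: x).
  move=> t0; rewrite -ler_pdivlMl//; apply/fle => s Ss.
  rewrite ler_pdivlMl//; apply/fge.
  by rewrite /S /= rmorphM -scalerA -scalerBr; apply: MZ => //; exact: ltW.
have fZ_pos (t : R) x : 0 < t -> f (t%:C *: x) = t * f x.
  move=> t0; apply/le_anti; rewrite fZ_ge// andbT.
  rewrite -ler_pdivrMl//.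
  have ti0 : 0 < t^-1 by rewrite invr_gt0.
  have := fZ_ge t^-1 (t%:C *: x) ti0.
  by rewrite scalerA -rmorphM mulVf ?gt_eqF// scale1r.
exists f; split=> //.
- move=> t x; have [t0|t0|->] := ltgtP t 0.
  + have nt0 : 0 < - t by rewrite oppr_gt0.
    apply/eqP; rewrite -eqr_opp -f_opp -scaleNr -rmorphN -mulNr.
    by apply/eqP; exact: fZ_pos.
  + exact: fZ_pos.
  + rewrite scale0r mul0r; apply: (addrI (f 0)).
    by rewrite -fD addr0 addr0.
- apply/le_anti/andP; split.
    apply/fle => t St; rewrite -subr_ge0; apply/Mneg.
    by rewrite rmorphB rmorph1 scalerBl scale1r.
  apply/fge; rewrite /S /= scale1r subrr -(scale0r e).
  exact: (MZ 0).
- by move=> x Qx; apply/fge; rewrite /S /= scale0r subr0; exact: QM.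
Qed.

(** The standard complexification [g x - i g (i x)] of a real functional [g], whose real part is
    [g]. *)
Lemma cone_complex_functional Q e : convex_cone Q -> ~ Q (- e) ->
  (forall x, exists2 t : R, 0 <= t & Q (t%:C *: e - x)) ->
  exists f : V -> R[i], [/\
    forall (c : R[i]) x y, f (c *: x + y) = c * f x + f y,
    complex.Re (f e) = 1 & forall x, Q x -> 0 <= complex.Re (f x)].
Proof.
move=> Qc Qe Qunit.
have [g [gD gZ ge gQ]] := cone_real_functional Qc Qe Qunit.
have gN x : g (- x) = - g x.
  by rewrite -scaleN1r -(rmorph1 (real_complex R)) -rmorphN gZ mulN1r.
exists (fun x => Complex (g x) (- g (Complex 0 1 *: x))); split=> //.
move=> [a b] x y.
have -> : Complex a b *: x = a%:C *: x + b%:C *: (Complex 0 1 *: x).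
  rewrite scalerA -scalerDl; congr (_ *: _); apply/eqP.
  by rewrite eq_complex /=; simpc.
have iC (t : R) z : Complex 0 1 *: (t%:C *: z) = t%:C *: (Complex 0 1 *: z).
  by rewrite !scalerA mulrC.
rewrite !scalerDr !gD !iC !gZ [Complex 0 1 *: (Complex 0 1 *: x)]scalerA.
have -> : Complex 0 1 * Complex 0 1 = - 1 :> R[i] by rewrite -expr2 sqr_i.
rewrite scaleN1r gN; apply/eqP; rewrite eq_complex /=; apply/andP; split.
  by apply/eqP; ring.
by apply/eqP; ring.
Qed.

End ConeFunctional.

(** * Joint states *)

Section CommutingSubalgebras.
Context {R : realType} {A : cstarAlgType R}.
Implicit Types (x y a b h p s : A) (B : set A) (phi : A -> R[i]).

Definition star_subalg B :=
  closed_subalg B /\ forall x, B x -> B (star x).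

Lemma stateD B phi : is_state B phi ->
  forall x y, B x -> B y -> phi (x + y) = phi x + phi y.
Proof.
by move=> st x y Bx By; rewrite -[x in LHS]scale1r (state_linear st)// mul1r.
Qed.

Lemma state0 B phi : closed_subalg B -> is_state B phi -> phi 0 = 0.
Proof.
move=> /closed_subalg0 B0 st.
by apply: (addrI (phi 0)); rewrite -(stateD st)// !addr0.
Qed.

Lemma stateZ B phi : closed_subalg B -> is_state B phi ->
  forall (c : R[i]) x, B x -> phi (c *: x) = c * phi x.
Proof.
move=> CB st c x Bx; have B0 := closed_subalg0 CB.
by rewrite -[_ *: _]addr0 (state_linear st)// (state0 CB st) addr0.
Qed.

(** Expanding [phi (star (1 + x) * (1 + x))], which is real, leaves [phi (star x)] as the only term
    not known to be real. *)
Lemma state_star_im B phi x : star_subalg B -> is_state B phi -> B x ->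
  phi x = 0 -> complex.Im (phi (star x)) = 0.
Proof.
move=> [CB SB] st Bx phix; have [_ B1 _ BM] := CB.
have Bs := SB _ Bx; have Bsx := BM _ _ Bs Bx.
have xx := state_pos st Bx.
have := state_pos st (closed_subalgD CB B1 Bx).
rewrite starD star1 mulrDl mul1r mulrDr mulr1.
have D := closed_subalgD CB.
rewrite !(stateD st) ?(state1 st) ?phix ?addr0//; [|exact: D..].
move=> /ger0_Im; rewrite !raddfD /= add0r => <-.
by rewrite (ger0_Im xx) addr0.
Qed.

(** The previous lemma for [x] kills the imaginary part of [phi (star x)], and for [i x] its real
    part. *)
Lemma state_star_eq0 B phi x : star_subalg B -> is_state B phi -> B x ->
  phi x = 0 -> phi (star x) = 0.
Proof.
move=> SB st Bx phix; have [CB SS] := SB.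
have im1 := state_star_im SB st Bx phix.
have Bix : B (Complex 0 1 *: x) by exact: closed_subalgZ.
have phiix : phi (Complex 0 1 *: x) = 0 by rewrite (stateZ CB st)// phix mulr0.
have := state_star_im SB st Bix phiix.
rewrite starZ (stateZ CB st); last exact: SS.
case: (phi (star x)) im1 => u v /= -> /=.
rewrite mul0r add0r mulN1r => /eqP; rewrite oppr_eq0 => /eqP ->.
by [].
Qed.

Lemma state_neg_not_square B phi h : star_subalg B -> is_state B phi -> B h ->
  star h = h -> phi h = -1 ->
  exists r s, [/\ B r, B s & [/\ star r = r, star s = s, s != 0 &
    r * h * r = - (s * s)]].
Proof.
move=> [CB SB] st Bh hs phih; have [[k [Bk ks hE]]|//] := cpos_dichotomy CB Bh hs.
have := state_pos st Bk; rewrite ks -hE phih oppr_ge0 => /le_lt_trans /(_ ltr01).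
by rewrite ltxx.
Qed.

Section JointState.
Context (B1 B2 : set A) (phi1 phi2 : A -> R[i]).
Context (SB1 : star_subalg B1) (SB2 : star_subalg B2).
Context (comm : forall x y, B1 x -> B2 y -> x * y = y * x).
Context (schlieder12 : schlieder B1 B2).
Context (st1 : is_state B1 phi1) (st2 : is_state B2 phi2).

(** The kernels are complex subspaces, so a functional with nonnegative real part on the cone
    vanishes on them. The summand [i s] with [s] of either sign makes it real on self-adjoint
    elements. *)
Definition joint_cone : set A := [set x | exists p a b s,
  [/\ cpos p, B1 a /\ phi1 a = 0, B2 b /\ phi2 b = 0, star s = s &
      x = p + (a + b) + 'i%R *: s]].

Lemma joint_cone_intro p a b s : cpos p -> B1 a -> phi1 a = 0 -> B2 b ->
  phi2 b = 0 -> star s = s -> joint_cone (p + (a + b) + 'i%R *: s).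
Proof. by move=> *; exists p, a, b, s. Qed.

Lemma joint_cone_convex : convex_cone joint_cone.
Proof.
have [CB1 _] := SB1; have [CB2 _] := SB2.
split.
  move=> _ _ [p [a [b [s [pp [Ba pa] [Bb pb] ss ->]]]]]
    [q [c [d [t [qp [Bc pc] [Bd pd] ts ->]]]]].
  rewrite addrACA -scalerDr addrACA [a + b + _]addrACA.
  apply: joint_cone_intro.
  - exact: cposD.
  - exact: closed_subalgD.
  - by rewrite (stateD st1)// pa pc addr0.
  - exact: closed_subalgD.
  - by rewrite (stateD st2)// pb pd addr0.
  - by rewrite starD ss ts.
move=> t _ t0 [p [a [b [s [pp [Ba pa] [Bb pb] ss ->]]]]].
rewrite !scalerDr scalerA mulrC -scalerA.
apply: joint_cone_intro.
- exact: cposZ.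
- exact: closed_subalgZ.
- by rewrite (stateZ CB1 st1)// pa mulr0.
- exact: closed_subalgZ.
- by rewrite (stateZ CB2 st2)// pb mulr0.
- by rewrite starZr ss.
Qed.

(* Compressing [h1 + h2] by [w = r1 r2] gives [- (s1 r2)^2 - (r1 s2)^2], where
   [s1 r2 <> 0] by the Schlieder property. *)
Lemma sum_states_not_cpos h1 h2 : B1 h1 -> star h1 = h1 -> phi1 h1 = -1 ->
  B2 h2 -> star h2 = h2 -> phi2 h2 = -1 -> ~ cpos (h1 + h2).
Proof.
have [[_ _ _ BM1] _] := SB1; have [[_ _ _ BM2] _] := SB2.
move=> Bh1 h1s p1 Bh2 h2s p2 /cpos_sqrt[k [[ks _] kE _]].
have [r1 [s1 [Br1 Bs1 [r1s s1s s1n E1]]]] := state_neg_not_square SB1 st1 Bh1 h1s p1.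
have [r2 [s2 [Br2 Bs2 [r2s s2s s2n E2]]]] := state_neg_not_square SB2 st2 Bh2 h2s p2.
have r2n : r2 != 0.
  apply: contra_neq s2n => r20; apply: sqr_eq0 => //.
  by apply/eqP; rewrite -oppr_eq0 -E2 r20 !mul0r.
have ss12 : star (s1 * r2) * (s1 * r2) = (s1 * s1) * (r2 * r2).
  have c : r2 * (s1 * s1) = (s1 * s1) * r2 by rewrite -comm//; exact: BM1.
  by rewrite starMr s1s r2s !mulrA -[r2 * s1 * s1]mulrA c -!mulrA.
have ss21 : star (r1 * s2) * (r1 * s2) = (r1 * r1) * (s2 * s2).
  have c : s2 * (r1 * r1) = (r1 * r1) * s2 by rewrite -comm//; exact: BM1.
  by rewrite starMr r1s s2s !mulrA -[s2 * r1 * r1]mulrA c -!mulrA.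
pose w := r1 * r2.
have ws : star w = w by rewrite starMr r1s r2s -comm.
have w1 : w * h1 * w = - ((s1 * s1) * (r2 * r2)).
  have c : r2 * (h1 * r1) = (h1 * r1) * r2 by rewrite -comm//; exact: BM1.
  rewrite -mulNr -E1 /w -!mulrA; congr (r1 * _).
  by rewrite !mulrA -[r2 * h1 * r1]mulrA c ?mulrA.
have w2 : w * h2 * w = - ((r1 * r1) * (s2 * s2)).
  have c : (r2 * h2) * r1 = r1 * (r2 * h2) by rewrite -comm//; exact: BM2.
  rewrite -mulrN -E2 /w -!mulrA; congr (r1 * _).
  by rewrite !mulrA c ?mulrA.
have ww : star (k * w) * (k * w) = w * h1 * w + w * h2 * w.
  by rewrite starMr ws ks -mulrDl -mulrDr -kE !mulrA.
have : (star (s1 * r2) * (s1 * r2)) +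
    (star (r1 * s2) * (r1 * s2) + star (k * w) * (k * w)) = 0.
  by rewrite ww w1 w2 ss12 ss21 -opprD addrA subrr.
move=> /cposD_eq0 z0.
have /star_mul_eq0/eqP : star (s1 * r2) * (s1 * r2) = 0.
  by apply: z0; [|apply: cposD]; exact: cpos_star_mul.
exact/negP/schlieder12.
Qed.

Lemma joint_cone_proper : ~ joint_cone (- 1).
Proof.
move=> [p [a [b [s [pp [Ba pa] [Bb pb] ss E]]]]].
have [CB1 S1] := SB1; have [CB2 S2] := SB2.
have [ps _] := pp; have [_ one1 _ _] := CB1; have [_ one2 _ _] := CB2.
have hE (B : set A) (c : A) : star_subalg B -> B c ->
    B (- (c + star c) - 1) /\ star (- (c + star c) - 1) = - (c + star c) - 1.
  move=> [CB SB] Bc; have [_ Bone _ _] := CB; split.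
    apply: closed_subalgB => //; rewrite -scaleN1r; apply: closed_subalgZ => //.
    by apply: closed_subalgD => //; exact: SB.
  by rewrite starB starN starD starK star1 [star c + c]addrC.
have hphi (B : set A) phi (c : A) : star_subalg B -> is_state B phi -> B c ->
    phi c = 0 -> phi (- (c + star c) - 1) = -1.
  move=> SB st Bc pc; have [CB SS] := SB; have [_ Bone _ _] := CB.
  have Bs := SS _ Bc; have Bcc := closed_subalgD CB Bc Bs.
  have BN x : B x -> B (- x) by move=> Bx; rewrite -scaleN1r; exact: closed_subalgZ.
  have phiN x : B x -> phi (- x) = - phi x.
    by move=> Bx; rewrite -scaleN1r (stateZ CB st)// mulN1r.
  rewrite (stateD st); [|exact: BN..].
  rewrite !phiN// (stateD st)// (state_star_eq0 SB st Bc pc) pc (state1 st).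
  by rewrite addr0 oppr0 add0r.
have [Bh1 h1s] := hE _ _ SB1 Ba; have [Bh2 h2s] := hE _ _ SB2 Bb.
(* The self-adjoint part of [- 1 = p + (a + b) + i s] gives
   [(- (a + star a) - 1) + (- (b + star b) - 1) = p + p]. *)
apply: (sum_states_not_cpos Bh1 h1s (hphi _ _ _ SB1 st1 Ba pa)
  Bh2 h2s (hphi _ _ _ SB2 st2 Bb pb)).
suff -> : - (a + star a) - 1 + (- (b + star b) - 1) = p + p by exact: cposD.
have Es : - 1 = p + (star a + star b) - 'i%R *: s.
  by rewrite -star1 -starN E !starD starZ conjCi scaleNr ps ss.
have -> : - (a + star a) - 1 + (- (b + star b) - 1) =
    - (a + star a + (b + star b)) + (-1 - 1) by rewrite addrACA -opprD.
rewrite {1}E Es [X in _ + X]addrACA subrr addr0.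
rewrite [X in _ + X]addrACA [a + b + _]addrACA.
by rewrite [LHS]addrC addrK.
Qed.


(** Only the real part [u] of [x] has to be dominated; the skew-adjoint part is absorbed by the
    summand [i s]. *)
Lemma joint_cone_unit x : exists2 t : R, 0 <= t & joint_cone (t%:C *: 1 - x).
Proof.
have [CB1 _] := SB1; have [CB2 _] := SB2.
pose u := 2^-1 *: (x + star x); pose s := 'i%R *: (2^-1 *: (x - star x)).
have us : star u = u.
  by rewrite /u star_half starD starK [star x + x]addrC.
have ss : star s = s.
  by rewrite /s starZ conjCi star_half starB starK scaleNr -!scalerN opprB.
have [t t0 tu] := cpos_shift us; exists t => //.
exists (t%:C *: 1 - u), 0, 0, s; split=> //.
- by split; [exact: closed_subalg0|exact: state0 CB1 st1].
- by split; [exact: closed_subalg0|exact: state0 CB2 st2].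
rewrite !addr0 -addrA; congr (_ + _).
have is_ : 'i%R *: s = - (2^-1 *: (x - star x)).
  by rewrite scalerA -expr2 sqrCi scaleN1r.
rewrite is_ -opprD -scalerDr addrACA subrr addr0 -mulr2n.
by rewrite -[X in _ *: X]scaler_nat scalerA mulVf ?pnatr_eq0// scale1r.
Qed.

Lemma joint_state_exists : exists psi, [/\ is_state [set: A] psi,
  forall x, B1 x -> psi x = phi1 x & forall x, B2 x -> psi x = phi2 x].
Proof.
have [CB1 _] := SB1; have [CB2 _] := SB2.
have [_ one1 _ _] := CB1; have [_ one2 _ _] := CB2.
have B10 := closed_subalg0 CB1; have B20 := closed_subalg0 CB2.
have p10 := state0 CB1 st1; have p20 := state0 CB2 st2.
have [f [fL f1 fQ]] :=
  cone_complex_functional joint_cone_convex joint_cone_proper joint_cone_unit.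
have f0 : f 0 = 0.
  by have := fL (-1) 0 0; rewrite scaler0 addr0 mulN1r addNr.
have fZ c x : f (c *: x) = c * f x by rewrite -[_ *: _]addr0 fL f0 addr0.
have Q_im s : star s = s -> joint_cone ('i%R *: s).
  move=> ss; exists 0, 0, 0, s; split=> //; first exact: cpos0.
  by rewrite !add0r.
have Q_pos p : cpos p -> joint_cone p.
  move=> pp; exists p, 0, 0, 0; split=> //; first exact: star0.
  by rewrite scaler0 !addr0.
have Q_ker1 x : B1 x -> phi1 x = 0 -> joint_cone x.
  move=> Bx px; exists 0, x, 0, 0; split=> //; [exact: cpos0|exact: star0|].
  by rewrite scaler0 add0r !addr0.
have Q_ker2 x : B2 x -> phi2 x = 0 -> joint_cone x.
  move=> Bx px; exists 0, 0, x, 0; split=> //; [exact: cpos0|exact: star0|].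
  by rewrite scaler0 !add0r addr0.
(* The real part of [f (i s)] is minus the imaginary part of [f s], and both [i s] and [- i s] lie
   in the cone. *)
have f_real s : star s = s -> complex.Im (f s) = 0.
  move=> ss; have := fQ _ (Q_im s ss).
  have /fQ : joint_cone ('i%R *: - s) by apply: Q_im; rewrite starN ss.
  rewrite -scaleN1r !fZ.
  by case: (f s) => a b /= ? ?; lra.
have fone : f 1 = 1.
  by apply/eqP; rewrite eq_complex f1 f_real ?eqxx// star1.
have f_ker x : (forall c : R[i], joint_cone (c *: x)) -> f x = 0.
  move=> cx; have := fQ _ (cx 1); have := fQ _ (cx (-1)).
  have := fQ _ (cx 'i%R); have := fQ _ (cx (- 'i%R)).
  rewrite !fZ.
  case: (f x) => a b /= ? ? ? ?.
  by apply/eqP; rewrite eq_complex /=; apply/andP; split; apply/eqP; lra.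
exists f; split.
- split=> //.
  move=> x _; have px := cpos_star_mul x; rewrite lecE /=.
  by rewrite f_real ?eqxx/= ?fQ//; [exact: Q_pos|case: px].
- move=> x Bx; apply/eqP; rewrite -subr_eq0; apply/eqP.
  (* Modulo the kernel of [phi1], on which [f] vanishes, [x] is the scalar [phi1 x], and
     [f 1 = 1]. *)
  have k0 : phi1 (x - phi1 x *: 1) = 0.
    by rewrite addrC -scaleNr (state_linear st1)// (state1 st1) mulr1 addNr.
  have Bk : B1 (x - phi1 x *: 1).
    by apply: closed_subalgB => //; exact: closed_subalgZ.
  have /f_ker : forall c : R[i], joint_cone (c *: (x - phi1 x *: 1)).
    move=> c; apply: Q_ker1; first exact: closed_subalgZ.
    by rewrite (stateZ CB1 st1)// k0 mulr0.
  by rewrite addrC -scaleNr fL fone mulr1 addrC.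
- move=> x Bx; apply/eqP; rewrite -subr_eq0; apply/eqP.
  have k0 : phi2 (x - phi2 x *: 1) = 0.
    by rewrite addrC -scaleNr (state_linear st2)// (state1 st2) mulr1 addNr.
  have Bk : B2 (x - phi2 x *: 1).
    by apply: closed_subalgB => //; exact: closed_subalgZ.
  have /f_ker : forall c : R[i], joint_cone (c *: (x - phi2 x *: 1)).
    move=> c; apply: Q_ker2; first exact: closed_subalgZ.
    by rewrite (stateZ CB2 st2)// k0 mulr0.
  by rewrite addrC -scaleNr fL fone mulr1 addrC.
Qed.

End JointState.
End CommutingSubalgebras.

(** * Even parts of subalgebras and averaging over the grading *)

Section EvenStates.
Context {R : realType} {A : cstarAlgType R} (theta : z2grading A).
Implicit Types (x y : A) (B : set A) (phi : A -> R[i]).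

Lemma star_subalg_even_part B :
  cstar_subalgebra B -> star_subalg (even_part theta B).
Proof.
move=> CB; split.
  exact/closed_subalg_even_part/cstar_subalgebra_closed_subalg.
have [_ [BS _]] := CB.
by move=> x [Bx tx]; split; [exact: BS|rewrite grading_star tx].
Qed.

Lemma is_state_even_part B phi :
  is_state B phi -> is_state (even_part theta B) phi.
Proof.
move=> st; split; last exact: state1 st.
  by move=> c x y [Bx _] [By _]; exact: (state_linear st).
by move=> x [Bx _]; exact: (state_pos st).
Qed.

Lemma graded_commute_even B1 B2 x y : graded_commute theta B1 B2 ->
  even_part theta B1 x -> even_part theta B2 y -> x * y = y * x.
Proof.
move=> comm [Bx tx] [By ty]; rewrite (comm x y)//; [|by left|by left].
rewrite /eps; case: ifPn => [/asboolP[ox _]|_]; last by rewrite scale1r.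
(* The sign is [-1] only if the even element [x] is odd as well, hence zero. *)
have x0 : x = 0.
  have : 2 *: x = 0 by rewrite scaler_nat mulr2n -{2}tx ox subrr.
  by move=> /eqP; rewrite scaler_eq0 pnatr_eq0 => /eqP.
by rewrite x0 mulr0 scaler0.
Qed.

(** The conditional expectation onto the fixed points of [theta]. *)
Definition even_mean x : A := 2^-1 *: (x + theta x).

Lemma even_mean_even x : theta (even_mean x) = even_mean x.
Proof. by rewrite /even_mean linearZ /= rmorphD /= gradingK [theta x + x]addrC. Qed.

Lemma even_mean_grading x : even_mean (theta x) = even_mean x.
Proof. by rewrite /even_mean gradingK [theta x + x]addrC. Qed.

Lemma even_mean_part B x : graded_subalgebra theta B -> B x ->
  even_part theta B (even_mean x).
Proof.
move=> [/cstar_subalgebra_closed_subalg CB tB] Bx.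
split; last exact: even_mean_even.
apply: closed_subalgZ => //; apply: closed_subalgD => //.
by apply: tB; exists x.
Qed.

Lemma even_state_even_mean B phi x : graded_subalgebra theta B ->
  even_state theta B phi -> B x -> phi (even_mean x) = phi x.
Proof.
move=> [/cstar_subalgebra_closed_subalg CB tB] [st phit] Bx.
have Btx : B (theta x) by apply: tB; exists x.
have BD := closed_subalgD CB Bx Btx.
rewrite (stateZ CB st)// (stateD st)// phit// -mulr2n -[phi x *+ 2]mulr_natl.
by rewrite mulrA mulVf ?pnatr_eq0// mul1r.
Qed.

(** Positivity survives because [theta (star x * x)] is again of the form [star y * y], with
    [y = theta x]. *)
Lemma even_state_mean phi :
  is_state setT phi -> even_state theta setT (phi \o even_mean).
Proof.
move=> st; split; last by move=> x _ /=; rewrite even_mean_grading.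
split.
- move=> c x y _ _ /=; rewrite -(state_linear st)//; congr phi.
  rewrite /even_mean rmorphD /= linearZ /= addrACA -scalerDr [LHS]scalerDr.
  by congr (_ + _); rewrite !scalerA mulrC.
- move=> x _ /=.
  rewrite (stateZ closed_subalg_setT st)// (stateD st)// rmorphM /= grading_star.
  by rewrite mulr_ge0 ?half_ge0// addr_ge0// (state_pos st).
- rewrite /= /even_mean rmorph1 -mulr2n -[X in _ *: X]scaler_nat scalerA.
  by rewrite mulVf ?pnatr_eq0// scale1r (state1 st).
Qed.

End EvenStates.

Theorem theorem3p3 (R : realType) (A : cstarAlgType R) (theta : z2grading A)
    (A1 A2 : set A) :
  graded_subalgebra theta A1 -> graded_subalgebra theta A2 ->
  graded_commute theta A1 A2 ->
  schlieder A1 A2 -> graded_cstar_independent theta A1 A2.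
Proof.
move=> G1 G2 comm schl phi1 phi2 ev1 ev2.
have [CA1 _] := G1; have [CA2 _] := G2; have [st1 _] := ev1; have [st2 _] := ev2.
have schl_even : schlieder (even_part theta A1) (even_part theta A2).
  by move=> x y [A1x _] [A2y _]; exact: schl.
have [psi [stpsi psi1 psi2]] := joint_state_exists
  (star_subalg_even_part theta CA1) (star_subalg_even_part theta CA2)
  (fun x y => graded_commute_even comm) schl_even
  (is_state_even_part theta st1) (is_state_even_part theta st2).
exists (psi \o even_mean theta); split; first exact: even_state_mean.
- move=> x A1x /=; rewrite psi1; last exact: even_mean_part.
  exact: even_state_even_mean ev1 A1x.
- move=> x A2x /=; rewrite psi2; last exact: even_mean_part.
  exact: even_state_even_mean ev2 A2x.
Qed.
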